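(* Let $m\in\mathbb N$ and $\alpha\le\omega$ with $1<2m<\alpha\le\omega$, and let $D\subseteq\mathbb N$. If $D$ is effective in $\mathcal O_m^\alpha$, then $D$ is recursive.
   Context: Write $e(n)$ for the (possibly undefined) value at $n$ of the $e$-th partial recursive function, and $\langle\cdot,\cdot\rangle$ for a fixed recursive bijective pairing on $\mathbb{N}$. $\mathcal P(X)$ is the power set. For $A,B\subseteq\mathbb{N}$ put $A\Rightarrow B=\{e : \text{for all } a\in A,\ e(a)\text{ is defined and } e(a)\in B\}$ and $A\wedge B=\{\langle a,b\rangle : a\in A, b\in B\}$. For $h,k:\mathcal P(\mathbb N)\to\mathcal P(\mathbb N)$ write $h\le k$ if $\bigcap_{p\subseteq\mathbb N}(h(p)\Rightarrow k(p))\ne\emptyset$. A local operator (Lawvere–Tierney topology) on the effective topos $\mathbf{Eff}$ is represented by a function $j:\mathcal P(\mathbb N)\to\mathcal P(\mathbb N)$ such that $\bigcap_p(p\Rightarrow j(p))$, $\bigcap_{p,q}(j(p\Rightarrow q)\Rightarrow(j(p)\Rightarrow j(q)))$ and $\bigcap_p(j(j(p))\Rightarrow j(p))$ are non-empty; local operators are ordered by $\le$ (functions $j,k$ with $j\le k\le j$ representing the same one). For $\theta:\mathbb N\to\mathcal P(\mathcal P(\mathbb N))$ put $\mathrm{mo}_\theta(p)=\{\langle n,e\rangle : \exists A\in\theta(n),\ e\in(A\Rightarrow p)\}$, and let $\mathrm{lo}_\theta$ be the least local operator $j$ with $\mathrm{mo}_\theta\le j$; it is represented by $\mathrm{lo}_\theta(p)=\bigcap_{q\subseteq\mathbb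 N}\big(((\mathrm{mo}_\theta(q)\Rightarrow q)\wedge(p\Rightarrow q))\Rightarrow q\big)$. Write $\eta\le_{\mathrm{lo}}\theta$ if $\mathrm{lo}_\eta\le\mathrm{lo}_\theta$. A collection $\mathcal A\in\mathcal P(\mathcal P(\mathbb N))$ is identified with the constant function $\mathbb N\to\mathcal P(\mathcal P(\mathbb N))$ with value $\mathcal A$. For $D\subseteq\mathbb N$, $\rho_D:\mathbb N\to\mathcal P(\mathcal P(\mathbb N))$ is $\rho_D(n)=\{\{0\}\}$ if $n\in D$ and $\rho_D(n)=\{\{1\}\}$ otherwise. $D$ is effective in $\theta$ (i.e. in the subtopos given by $\theta$) if $\rho_D\le_{\mathrm{lo}}\theta$; equivalently, $\bigcap_{n}(\{n\}\Rightarrow\mathrm{lo}_\theta(\{\chi_D(n)\}))\neq\emptyset$, where $\chi_D(n)=0$ if $n\in D$ and $1$ otherwise. For $1<2m<\alpha\le\omega$, $\mathcal O_m^\alpha$ is the collection of all subsets of $\alpha=\{n\in\mathbb N: n<\alpha\}$ whose complement in $\alpha$ has exactly $m$ elements. *)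

(* Defs.v *)
From Stdlib Require Cantor.
From mathcomp Require Import all_boot.
From mathcomp Require Import boolp classical_sets functions cardinality.

Set Implicit Arguments.
Unset Strict Implicit.
Unset Printing Implicit Defensive.

Local Open Scope classical_set_scope.
Local Open Scope card_scope.

(* The recursive bijective pairing <a, b> is Cantor's. *)
Definition pr (a b : nat) : nat := Cantor.to_nat (a, b).

Lemma pr_inj a b c d : pr a b = pr c d -> a = c /\ b = d.
Proof. by move=> /Cantor.to_nat_inj[-> ->]. Qed.

(* Programs for the unary partial recursive functions; functions of several
   arguments are represented through iterated pairing. *)
Inductive code : Set :=
  | Zero | Succ | Fst | Snd
  | Pair of code & code
  | Comp of code & code
  | Prec of code & code
  | Mu of code.

(* The graph of [c]: [eval c x y] means that [c] halts on [x] with value [y].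
   The equations are
     Prec f g <a, 0>   = f a,
     Prec f g <a, n+1> = g <a, <n, Prec f g <a, n>>>,
     Mu f a            = the least y such that f <a, y> = 0, provided that
                         f <a, z> is defined for all z < y. *)
Fixpoint eval (c : code) : nat -> nat -> Prop :=
  match c with
  | Zero => fun _ y => y = 0
  | Succ => fun x y => y = x.+1
  | Fst => fun x y => exists b, x = pr y b
  | Snd => fun x y => exists a, x = pr a y
  | Pair f g => fun x y => exists a b, [/\ eval f x a, eval g x b & y = pr a b]
  | Comp f g => fun x y => exists2 z, eval g x z & eval f z y
  | Prec f g => fun x y => exists a n, x = pr a n /\
      (fix rec (n : nat) (y : nat) : Prop :=
         match n with
         | 0 => eval f a y
         | k.+1 => exists2 z, rec k z & eval g (pr a (pr k z)) y
         end) n y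
  | Mu f => fun x y =>
      eval f (pr x y) 0 /\
      forall z, z < y -> exists w, eval f (pr x z) w.+1
  end.

Lemma eval_fun c x y z : eval c x y -> eval c x z -> y = z.
Proof.
elim: c x y z => /=.
- by move=> x y z -> ->.
- by move=> x y z -> ->.
- by move=> x y z [b ->] [b' /pr_inj[]].
- by move=> x y z [b ->] [b' /pr_inj[]].
- move=> f IHf g IHg x y z [a [b [fa gb ->]]] [a' [b' [fa' gb' ->]]].
  by rewrite (IHf _ _ _ fa fa') (IHg _ _ _ gb gb').
- move=> f IHf g IHg x y z [a ga fa] [b gb fb].
  by move: fb; rewrite -(IHg _ _ _ ga gb); apply: IHf.
- move=> f IHf g IHg x y z [a [n [-> ry]]] [a' [n' [/pr_inj[<- <-]]]].
  elim: n y z ry => [|n IHn] y z; first exact: IHf.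
  move=> [u ru gu] [v rv gv].
  by move: gv; rewrite -(IHn _ _ ru rv); apply: IHg.
- move=> f IHf x y z [y0 yP] [z0 zP].
  case: (ltngtP y z) => // [yz|zy].
  + by have [w /(IHf _ _ _ y0)] := zP _ yz.
  + by have [w /(IHf _ _ _ z0)] := yP _ zy.
Qed.

Fixpoint encode (c : code) : nat :=
  match c with
  | Zero => pr 0 0
  | Succ => pr 1 0
  | Fst => pr 2 0
  | Snd => pr 3 0
  | Pair f g => pr 4 (pr (encode f) (encode g))
  | Comp f g => pr 5 (pr (encode f) (encode g))
  | Prec f g => pr 6 (pr (encode f) (encode g))
  | Mu f => pr 7 (encode f)
  end.

Lemma encode_inj : injective encode.
Proof.
elim=> [||||f IHf g IHg|f IHf g IHg|f IHf g IHg|f IHf]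
       [||||f' g'|f' g'|f' g'|f'] /pr_inj[] //= _.
- by move=> /pr_inj[/IHf -> /IHg ->].
- by move=> /pr_inj[/IHf -> /IHg ->].
- by move=> /pr_inj[/IHf -> /IHg ->].
- by move=> /IHf ->.
Qed.

(* [app e n y]: the [e]-th partial recursive function is defined at [n] with
   value [y].  A number that encodes no program names the nowhere defined
   function. *)
Definition app (e n y : nat) : Prop :=
  exists2 c, encode c = e & eval c n y.

Lemma app_fun e n y z : app e n y -> app e n z -> y = z.
Proof. by move=> [c <- cy] [d /encode_inj -> /(eval_fun cy)]. Qed.

Definition chi (D : set nat) (n : nat) : nat := if n \in D then 0 else 1.

Definition recursive (D : set nat) : Prop :=
  exists e, forall n, app e n (chi D n).

Definition imp (A B : set nat) : set nat :=
  [set e | forall a, A a -> exists2 b, app e a b & B b].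

Definition wedge (A B : set nat) : set nat :=
  [set pr a b | a in A & b in B].

Definition le_op (h k : set nat -> set nat) : Prop :=
  (\bigcap_p imp (h p) (k p)) !=set0.

Definition mo (theta : nat -> set (set nat)) (p : set nat) : set nat :=
  [set x | exists n e, x = pr n e /\ exists2 A, theta n A & imp A p e].

(* The canonical representative of the least local operator above [mo theta]. *)
Definition lo (theta : nat -> set (set nat)) (p : set nat) : set nat :=
  \bigcap_q imp (wedge (imp (mo theta q) q) (imp p q)) q.

Definition le_lo (eta theta : nat -> set (set nat)) : Prop :=
  le_op (lo eta) (lo theta).

Definition rho (D : set nat) (n : nat) : set (set nat) :=
  if n \in D then [set [set 0]] else [set [set 1]].

Definition effective_in (D : set nat) (theta : nat -> set (set nat)) : Prop :=
  le_lo (rho D) theta.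

(* An ordinal alpha <= omega is an [option nat], with [None] for omega. *)
Definition lt_ord (n : nat) (alpha : option nat) : bool :=
  if alpha is Some a then n < a else true.

Definition ord_set (alpha : option nat) : set nat := [set n | lt_ord n alpha].

Definition O_ (m : nat) (alpha : option nat) : set (set nat) :=
  [set A | A `<=` ord_set alpha /\ (ord_set alpha `\` A) #= `I_m].

(* Main.v *)
Require Import Defs.
From Stdlib Require Cantor.
From mathcomp Require Import all_boot.
From mathcomp Require Import boolp classical_sets functions cardinality.

Set Implicit Arguments.
Unset Strict Implicit.
Unset Printing Implicit Defensive.

Local Open Scope classical_set_scope.
Local Open Scope card_scope.

(* For v in {0, 1} let q_v be the least set that contains <0, v> and contains
   <t + 1, e> as soon as e(a) is defined and in q_v for at least m + 1 of the
   2m + 1 numbers a <= 2m.  Two majorities meet, so q_0 and q_1 are disjoint.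
   A member of O_m^alpha misses only m numbers, so it contains a majority of
   {0, ..., 2m}; hence <n, e> |-> <1, e> realizes mo(q_v) => q_v.  A realizer of
   the effectiveness of D thus computes from n an element of q_{chi_D(n)}.
   As q_0 and q_1 are recursively enumerable, D can be decided by waiting until
   this element shows up in one of them. *)

(** * Computable total functions over Cantor pairing *)

Definition pfst (n : nat) : nat := (Cantor.of_nat n).1.
Definition psnd (n : nat) : nat := (Cantor.of_nat n).2.

Lemma pfstE a b : pfst (pr a b) = a.
Proof. by rewrite /pfst /pr Cantor.cancel_of_to. Qed.

Lemma psndE a b : psnd (pr a b) = b.
Proof. by rewrite /psnd /pr Cantor.cancel_of_to. Qed.

Definition prE := (pfstE, psndE).

Lemma prK n : pr (pfst n) (psnd n) = n.
Proof. by rewrite /pr /pfst /psnd -surjective_pairing Cantor.cancel_to_of. Qed.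

Definition computable (f : nat -> nat) : Prop :=
  exists c, forall x, eval c x (f x).

Lemma computable_id : computable (fun x => x).
Proof.
exists (Pair Fst Snd) => x /=; exists (pfst x), (psnd x).
by split; [exists (psnd x) | exists (pfst x) |]; rewrite prK.
Qed.

Lemma computable_succ f : computable f -> computable (fun x => (f x).+1).
Proof. by move=> [c cf]; exists (Comp Succ c) => x /=; exists (f x). Qed.

Fixpoint const_code (n : nat) : code :=
  if n is k.+1 then Comp Succ (const_code k) else Zero.

Lemma eval_const_code n x : eval (const_code n) x n.
Proof. by elim: n => //= n IHn; exists n. Qed.

Lemma computable_const n : computable (fun _ => n).
Proof. by exists (const_code n) => x; apply: eval_const_code. Qed.

Lemma computable_pr f g :
  computable f -> computable g -> computable (fun x => pr (f x) (g x)).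
Proof. by move=> [c cf] [d dg]; exists (Pair c d) => x /=; exists (f x), (g x). Qed.

Lemma computable_comp f g :
  computable g -> computable f -> computable (fun x => g (f x)).
Proof. by move=> [c cg] [d df]; exists (Comp c d) => x /=; exists (f x). Qed.

Lemma computable_pfst f : computable f -> computable (fun x => pfst (f x)).
Proof.
apply: computable_comp; exists Fst => x /=.
by exists (psnd x); rewrite prK.
Qed.

Lemma computable_psnd f : computable f -> computable (fun x => psnd (f x)).
Proof.
apply: computable_comp; exists Snd => x /=.
by exists (pfst x); rewrite prK.
Qed.

Lemma computable_rec (F : nat -> nat) (G : nat -> nat -> nat -> nat) a n :
    computable F ->
    computable (fun u => G (pfst u) (pfst (psnd u)) (psnd (psnd u))) ->
    computable a -> computable n ->
  computable (fun x => nat_rect (fun _ => nat) (F (a x)) (G (a x)) (n x)).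
Proof.
move=> [c cF] [d dG] ca cn.
pose h u := nat_rect (fun _ => nat) (F (pfst u)) (G (pfst u)) (psnd u).
have [k ck] : computable h.
  exists (Prec c d) => u /=; exists (pfst u), (psnd u); split; first by rewrite prK.
  rewrite /h; elim: (psnd u) => [|i IHi] //=.
  eexists; first exact: IHi.
  by have := dG (pr (pfst u) (pr i (nat_rect (fun=> nat) (F (pfst u))
    (G (pfst u)) i))); rewrite !prE.
have [l cl] := computable_comp (ex_intro _ k ck) (computable_pr ca cn).
by exists l => x; have := cl x; rewrite /h !prE.
Qed.

(** A case distinction is a primitive recursion whose step ignores the previous value. *)
Lemma computable_case (N A : nat -> nat) (B : nat -> nat -> nat) :
    computable N -> computable A ->
    computable (fun u => B (pfst u) (psnd u)) ->
  computable (fun x => if N x is k.+1 then B x k else A x).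
Proof.
move=> cN cA cB.
have cB' : computable (fun u => B (pfst u) (pfst (psnd u))).
  have [d cd] := computable_comp cB (computable_pr
    (computable_pfst computable_id)
    (computable_pfst (computable_psnd computable_id))).
  by exists d => x; have := cd x; rewrite !prE.
have [c cc] := computable_rec (G := fun a k _ => B a k) cA cB' computable_id cN.
by exists c => x; have := cc x; case: (N x).
Qed.

Lemma computable_iter f n a :
  computable f -> computable n -> computable a ->
  computable (fun x => iter (n x) f (a x)).
Proof.
move=> cf cn ca.
have [c cc] := computable_rec (G := fun _ _ z => f z) computable_id
  (computable_comp cf (computable_psnd (computable_psnd computable_id))) ca cn.
by exists c => x; have := cc x; elim: (n x) (eval c x).
Qed.

Lemma computable_sub f g :
  computable f -> computable g -> computable (fun x => f x - g x).
Proof.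
move=> cf cg.
have cp : computable predn.
  have [c cc] := computable_case (B := fun _ k => k) computable_id
    (computable_const 0) (computable_psnd computable_id).
  by exists c => x; have := cc x; case: x.
have [c cc] := computable_iter cp cg cf.
by exists c => x; rewrite -iter_predn.
Qed.

Lemma computable_eq (a b f g : nat -> nat) :
  computable a -> computable b -> computable f -> computable g ->
  computable (fun x => if a x == b x then f x else g x).
Proof.
move=> ca cb cf cg.
have cab := computable_sub ca cb; have cba := computable_sub cb ca.
have cgf h : computable h -> computable (fun u => h (pfst u)).
  by move=> ch; apply: computable_comp ch (computable_pfst computable_id).
have [c cc] := computable_case (B := fun x _ => g x) cab
  (computable_case (B := fun x _ => g x) cba cf (cgf _ cg)) (cgf _ cg).
exists c => x; have := cc x; rewrite eqn_leq /leq.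
by case: (a x - b x) (b x - a x) => [|?] [|?].
Qed.

(** * A complete proof search for membership in q_v *)

(* A goal is a number, a list of goals is 0 or [gcons g G].  The goals are, in
   this order: program [c] maps [x] to [y]; [f] is defined and nonzero at
   [<x, z>] for all [z < k]; [y] is in [q_v]; at least [k] of the [e(a)], [a < j],
   are in [q_v].  In [step m h G], the hint [h] is a guess for the existential
   witness needed to reduce the first goal of [G].  A first goal that is
   refuted stays in place, so that the list never becomes empty. *)
Definition gcons (g G : nat) : nat := (pr g G).+1.
Definition geval (c x y : nat) : nat := pr 0 (pr c (pr x y)).
Definition gbelow (f x k : nat) : nat := pr 1 (pr f (pr x k)).
Definition gelects (v y : nat) : nat := pr 2 (pr v y).
Definition gvotes (v e j k : nat) : nat := pr 3 (pr (pr v e) (pr j k)).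

Definition step_eval (h G G' c x y : nat) : nat :=
  if pfst c == 0 then if y == 0 then G' else G
  else if pfst c == 1 then if y == x.+1 then G' else G
  else if pfst c == 2 then if y == pfst x then G' else G
  else if pfst c == 3 then if y == psnd x then G' else G
  else if pfst c == 4 then
    gcons (geval (pfst (psnd c)) x (pfst y))
      (gcons (geval (psnd (psnd c)) x (psnd y)) G')
  else if pfst c == 5 then
    gcons (geval (psnd (psnd c)) x h) (gcons (geval (pfst (psnd c)) h y) G')
  else if pfst c == 6 then
    if psnd x is k.+1 then
      gcons (geval c (pr (pfst x) k) h)
        (gcons (geval (psnd (psnd c)) (pr (pfst x) (pr k h)) y) G')
    else gcons (geval (pfst (psnd c)) (pfst x) y) G'
  else gcons (geval (psnd c) (pr x y) 0) (gcons (gbelow (psnd c) x y) G').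

Definition step_below (h G' f x k : nat) : nat :=
  if k is i.+1 then gcons (geval f (pr x i) h.+1) (gcons (gbelow f x i) G')
  else G'.

Definition step_elects (m G G' v y : nat) : nat :=
  if pfst y is _.+1 then gcons (gvotes v (psnd y) (2 * m).+1 m.+1) G'
  else if psnd y == v then G' else G.

(** Voters are settled from [j'] downwards: hint 0 skips the voter, hint [y.+1] counts it with the
    guessed value [y]. *)
Definition step_votes (h G G' v e j k : nat) : nat :=
  if k is k'.+1 then
    if j is j'.+1 then
      if h is y.+1 then
        gcons (geval e j' y) (gcons (gelects v y) (gcons (gvotes v e j' k') G'))
      else gcons (gvotes v e j' k) G'
    else G
  else G'.

Definition step_goal (m h G g G' : nat) : nat :=
  if pfst g == 0 then
    step_eval h G G' (pfst (psnd g)) (pfst (psnd (psnd g))) (psnd (psnd (psnd g)))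
  else if pfst g == 1 then
    step_below h G' (pfst (psnd g)) (pfst (psnd (psnd g))) (psnd (psnd (psnd g)))
  else if pfst g == 2 then
    step_elects m G G' (pfst (psnd g)) (psnd (psnd g))
  else
    step_votes h G G' (pfst (pfst (psnd g))) (psnd (pfst (psnd g)))
      (pfst (psnd (psnd g))) (psnd (psnd (psnd g))).

Definition step (m h G : nat) : nat :=
  if G is p.+1 then step_goal m h G (pfst p) (psnd p) else 0.

(** A state pairs a stack of hints with a list of goals; each step pops one hint. Unpairing never
    fails, so every number serves as a stack. *)
Definition step_state (m s : nat) : nat :=
  pr (psnd (pfst s)) (step m (pfst (pfst s)) (psnd s)).

Definition provable (m G : nat) : Prop :=
  exists n hs, psnd (iter n (step_state m) (pr hs G)) = 0.

Ltac solve_computable :=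
  rewrite /gcons /geval /gbelow /gelects /gvotes;
  repeat first
  [ exact: computable_id
  | exact: computable_const
  | assumption
  | apply: computable_pfst
  | apply: computable_psnd
  | apply: computable_pr
  | apply: computable_succ
  | apply: computable_eq
  | apply: computable_case ].

Lemma computable_step_state m : computable (step_state m).
Proof.
rewrite /step_state /step /step_goal /step_eval /step_below /step_elects /step_votes.
solve_computable.
Qed.

(** * The sets [q_v] and the uniqueness of the elected value *)

Section Election.
Variables (A : nat -> nat -> nat -> Prop) (m v : nat).

(** This is [q_v] over an evaluation relation [A]: [app] gives the true set, [weak_app] the one that
    proof search certifies. *)
Inductive elects : nat -> Prop :=
  | elects_leaf : elects (pr 0 v)
  | elects_node t e : votes e (2 * m).+1 m.+1 -> elects (pr t.+1 e)
with votes : nat -> nat -> nat -> Prop :=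
  | votes_enough e j : votes e j 0
  | votes_skip e j k : votes e j k -> votes e j.+1 k
  | votes_take e j k y :
      A e j y -> elects y -> votes e j k -> votes e j.+1 k.+1.

End Election.

Scheme elects_votes_ind := Induction for elects Sort Prop
with votes_elects_ind := Induction for votes Sort Prop.

(* Proof search never checks that a number names a program, hence its goals
   only say what the number computes if it does. *)
Definition weak_app (e x y : nat) : Prop := forall c, encode c = e -> eval c x y.

Lemma elects_inv A m v y : elects A m v y ->
  if pfst y is _.+1 then votes A m v (psnd y) (2 * m).+1 m.+1 else psnd y = v.
Proof. by case=> [|t e ve]; rewrite !prE. Qed.

Lemma elects_intro A m v y :
  (if pfst y is _.+1 then votes A m v (psnd y) (2 * m).+1 m.+1 else psnd y = v) ->
  elects A m v y.
Proof.
rewrite -{4}(prK y); case: (pfst y) => [|t]; last exact: elects_node.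
by move=> ->; apply: elects_leaf.
Qed.

Lemma votes_inv A m v e j k : votes A m v e j k.+1 ->
  if j is i.+1 then votes A m v e i k.+1 \/
    exists y, [/\ A e i y, elects A m v y & votes A m v e i k]
  else False.
Proof.
move Ek: k.+1 => k1 vk; case: vk Ek => // {}e {}j.
  by move=> i vi _; left.
by move=> i y ey vy vi [->]; right; exists y.
Qed.

Lemma votes_le A m v e j k : votes A m v e j k -> k <= j.
Proof.
elim: j k => [|j IHj] [|k] //; first by move/votes_inv.
by move=> /votes_inv[/IHj /leqW|[y [_ _ /IHj]]].
Qed.

(* Two strict majorities share a voter, whose value is unique. *)
Lemma elects_unique m v v' y :
  elects app m v y -> elects weak_app m v' y -> v = v'.
Proof.
move=> vy; move: y vy v'.
(* Claim for votes: either a common voter forces [v = v'], or the two groups fit disjointly among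
   the first [j] voters. Two groups of [m.+1] do not fit among [2 * m + 1]. *)
apply: (elects_votes_ind
  (P := fun y _ => forall v', elects weak_app m v' y -> v = v')
  (P0 := fun e j k _ => forall v' k', votes weak_app m v' e j k' ->
    v = v' \/ k + k' <= j)).
- by move=> v' /elects_inv; rewrite !prE.
- move=> t e _ IH v' /elects_inv; rewrite !prE => /IH[//|].
  by rewrite addnn -mul2n mulnS add2n ltnn.
- by move=> e j v' k' /votes_le; right.
- move=> e j k vk IH v' [|k']; first by right; rewrite addn0 ltnW // ltnS (votes_le vk).
  move=> /votes_inv[/IH[->|/leqW]|[y [_ _ /IH[->|]]]]; [by left|by right|by left|].
  by right; rewrite addnS ltnS.
- move=> e j k y [c ce cy] _ IHy vk IH v' [|k'].
    by right; rewrite addn0 ltnS (votes_le vk).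
  move=> /votes_inv[/IH[->|]|[z [/(_ c ce) cz vz _]]]; [by left|by right|].
  by left; apply: IHy; rewrite (eval_fun cy cz).
Qed.

(** * Soundness of the proof search *)

Definition holds (m g : nat) : Prop :=
  match pfst g with
  | 0 => weak_app (pfst (psnd g)) (pfst (psnd (psnd g))) (psnd (psnd (psnd g)))
  | 1 => forall z, z < psnd (psnd (psnd g)) ->
      exists w, weak_app (pfst (psnd g)) (pr (pfst (psnd (psnd g))) z) w.+1
  | 2 => elects weak_app m (pfst (psnd g)) (psnd (psnd g))
  | _ => votes weak_app m (pfst (pfst (psnd g))) (psnd (pfst (psnd g)))
      (pfst (psnd (psnd g))) (psnd (psnd (psnd g)))
  end.

Inductive all_hold (m : nat) : nat -> Prop :=
  | all_hold_nil : all_hold m 0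
  | all_hold_cons g G : holds m g -> all_hold m G -> all_hold m (gcons g G).

Lemma all_hold_inv m g G : all_hold m (gcons g G) -> holds m g /\ all_hold m G.
Proof.
move EH: (gcons g G) => H mH.
by case: mH EH => // g' G' ? ? [/pr_inj[-> ->]].
Qed.

Lemma step_gcons m h g G : step m h (gcons g G) = step_goal m h (gcons g G) g G.
Proof. by rewrite /step /= !prE. Qed.

(** Here [G] is the whole list and [G'] its tail; the first alternative covers a refuted goal, which
    leaves [G] as it is. *)
Lemma step_eval_sound m h G G' c x y :
  all_hold m (step_eval h G G' c x y) ->
  all_hold m G \/ weak_app c x y /\ all_hold m G'.
Proof.
have inv c' x' y' H : all_hold m (gcons (geval c' x' y') H) ->
    weak_app c' x' y' /\ all_hold m H.
  by move=> /all_hold_inv[]; rewrite /holds !prE.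
rewrite /step_eval; case Ec: (pfst c) => [|[|[|[|[|[|[|t]]]]]]] /=.
- case: eqP => [-> mG'|]; last by left.
  by right; split=> //; case=> //= *; subst c; rewrite prE in Ec.
- case: eqP => [-> mG'|]; last by left.
  by right; split=> //; case=> //= *; subst c; rewrite prE in Ec.
- case: eqP => [-> mG'|]; last by left.
  right; split=> //; case=> //= *; subst c; rewrite ?prE // in Ec.
  by exists (psnd x); rewrite prK.
- case: eqP => [-> mG'|]; last by left.
  right; split=> //; case=> //= *; subst c; rewrite ?prE // in Ec.
  by exists (pfst x); rewrite prK.
- move=> /inv[fx /inv[gx mG']].
  right; split=> //; case=> //= *; subst c; rewrite !prE in Ec fx gx => //.
  by exists (pfst y), (psnd y); split; [exact: fx|exact: gx|rewrite prK].
- move=> /inv[gx /inv[fy mG']].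
  right; split=> //; case=> //= *; subst c; rewrite !prE in Ec fy gx => //.
  by exists h; [exact: gx|exact: fy].
- case Ex: (psnd x) => [|k].
    move=> /inv[fx mG']; right; split=> //; case=> //= *; subst c.
    1-6,8: by rewrite !prE in Ec.
    exists (pfst x), 0; rewrite -{1}Ex prK; split=> //.
    by apply: fx; rewrite !prE.
  move=> /inv[rx /inv[gy mG']]; right; split=> //; case=> //= *; subst c.
  1-6,8: by rewrite !prE in Ec.
  exists (pfst x), k.+1; rewrite -{1}Ex prK; split=> //.
  have [a [n [/pr_inj[<- <-] rz]]] := rx (Prec _ _) erefl.
  by exists h => //; apply: gy; rewrite !prE.
(* Every tag from 7 on is reduced like [Mu]; a larger tag names no program, so [weak_app] is vacuous
   there. *)
- move=> /inv[f0 /all_hold_inv[]]; rewrite /holds !prE => fS mG'.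
  right; split=> //; case=> //= *; subst c; rewrite !prE in Ec f0 fS => //.
  split; first exact: f0.
  by move=> z /fS[w fw]; exists w; apply: fw.
Qed.

Lemma step_sound m h G : all_hold m (step m h G) -> all_hold m G.
Proof.
case: G => [//|p]; rewrite -(prK p); move: (pfst p) (psnd p) => g G'.
rewrite -/(gcons g G') step_gcons => mG.
suff [|[]] : all_hold m (gcons g G') \/ holds m g /\ all_hold m G'; first by [].
  exact: all_hold_cons.
move: (gcons g G') mG => G; rewrite /step_goal /holds.
case: (pfst g) => [|[|[|t]]] /=; move: (psnd g) => {}g.
- move: (pfst g) (pfst (psnd g)) (psnd (psnd g)) => c x y.
  exact: step_eval_sound.
- rewrite /step_below.
  case: (psnd (psnd g)) => [|k]; first by right.
  move=> /all_hold_inv[fk /all_hold_inv[]]; rewrite /holds !prE in fk * => fi mG'.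
  right; split=> // z; rewrite ltnS leq_eqVlt => /orP[/eqP ->|/fi //].
  by exists h.
- rewrite /step_elects.
  case Ey: (pfst (psnd g)) => [|t].
    case: eqP => [Ev mG'|]; last by left.
    by right; split=> //; apply: elects_intro; rewrite Ey.
  move=> /all_hold_inv[]; rewrite /holds !prE => ve mG'.
  by right; split=> //; apply: elects_intro; rewrite Ey.
- rewrite /step_votes.
  move: (pfst (pfst g)) (psnd (pfst g)) (pfst (psnd g)) (psnd (psnd g)) => v e j k.
  case: k => [|k]; first by right; split=> //; apply: votes_enough.
  case: j => [|j]; first by left.
  case: h => [|y].
    move=> /all_hold_inv[]; rewrite /holds !prE => ve mG'.
    by right; split=> //; apply: votes_skip.
  move=> /all_hold_inv[ey /all_hold_inv[vy /all_hold_inv[ve mG']]].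
  rewrite /holds !prE in ey vy ve.
  by right; split=> //; apply: votes_take ey vy ve.
Qed.

Lemma provable_sound m G : provable m G -> all_hold m G.
Proof.
move=> [n [hs]]; elim: n hs G => [|n IHn] hs G.
  by rewrite /= prE => ->; apply: all_hold_nil.
by rewrite iterSr /step_state !prE => /IHn; apply: step_sound.
Qed.

(** * Completeness of the proof search *)

Lemma provable0 m : provable m 0.
Proof. by exists 0, 0; rewrite /= prE. Qed.

Lemma provable_step m h G : provable m (step m h G) -> provable m G.
Proof.
move=> [n [hs nG]]; exists n.+1, (pr h hs).
by rewrite iterSr /step_state !prE.
Qed.

(** Induction on the program, with the true intermediate values as hints. The arbitrary tail [G]
    lets the several goals pushed by one reduction be discharged one after the other. *)
Lemma provable_eval m c x y G : eval c x y -> provable m G ->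
  provable m (gcons (geval (encode c) x y) G).
Proof.
have stepE h c' x' y' H : step m h (gcons (geval c' x' y') H) =
    step_eval h (gcons (geval c' x' y') H) H c' x' y'.
  by rewrite step_gcons /step_goal !prE.
elim: c x y G => /=.
- by move=> x y G -> mG; apply: (@provable_step _ 0); rewrite stepE /step_eval !prE.
- move=> x y G -> mG; apply: (@provable_step _ 0).
  by rewrite stepE /step_eval !prE /= eqxx.
- move=> x y G [b ->] mG; apply: (@provable_step _ 0).
  by rewrite stepE /step_eval !prE /= eqxx.
- move=> x y G [b ->] mG; apply: (@provable_step _ 0).
  by rewrite stepE /step_eval !prE /= eqxx.
- move=> f IHf g IHg x y G [a [b [fa gb ->]]] mG; apply: (@provable_step _ 0).
  by rewrite stepE /step_eval !prE /=; apply/IHf/IHg.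
- move=> f IHf g IHg x y G [z gz fz] mG; apply: (@provable_step _ z).
  by rewrite stepE /step_eval !prE /=; apply/IHg/IHf.
- move=> f IHf g IHg x y G [a [n [-> ry]]] mG.
  elim: n y ry G mG => [|n IHn] y ry G mG.
    apply: (@provable_step _ 0).
    by rewrite stepE /step_eval !prE /=; apply: IHf.
  case: ry => z rz gz; apply: (@provable_step _ z).
  by rewrite stepE /step_eval !prE /=; apply: IHn => //; apply: IHg.
- move=> f IHf x y G [f0 fS] mG; apply: (@provable_step _ 0).
  rewrite stepE /step_eval !prE /=; apply: (IHf) => //.
  (* What remains is the [gbelow] goal, removed by induction on its bound. *)
  elim: y fS {f0} => [|k IHk] fS.
    apply: (@provable_step _ 0).
    by rewrite step_gcons /step_goal !prE /= /step_below.
  have [w fw] := fS _ (ltnSn k).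
  apply: (@provable_step _ w).
  rewrite step_gcons /step_goal !prE /= /step_below.
  by apply: IHf => //; apply: IHk => z /leqW /fS.
Qed.

Lemma provable_app m e x y G : app e x y -> provable m G ->
  provable m (gcons (geval e x y) G).
Proof. by move=> [c <-]; apply: provable_eval. Qed.

Lemma provable_elects m v y : elects app m v y ->
  forall G, provable m G -> provable m (gcons (gelects v y) G).
Proof.
move: y; apply: (elects_votes_ind
  (P := fun y _ => forall G, provable m G -> provable m (gcons (gelects v y) G))
  (P0 := fun e j k _ =>
    forall G, provable m G -> provable m (gcons (gvotes v e j k) G))).
- move=> G mG; apply: (@provable_step _ 0).
  by rewrite step_gcons /step_goal !prE /= /step_elects !prE eqxx.
- move=> t e _ IH G mG; apply: (@provable_step _ 0).
  by rewrite step_gcons /step_goal !prE /= /step_elects !prE; apply: IH.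
- move=> e j G mG; apply: (@provable_step _ 0).
  by rewrite step_gcons /step_goal !prE /= /step_votes.
- move=> e j [|k] _ IH G mG; apply: (@provable_step _ 0);
    rewrite step_gcons /step_goal !prE //= /step_votes.
  exact: IH.
- move=> e j k y ey _ IHy _ IH G mG; apply: (@provable_step _ y.+1).
  rewrite step_gcons /step_goal !prE //= /step_votes.
  by apply: provable_app => //; apply/IHy/IH.
Qed.

(** * Unbounded search and a universal program *)

(** Minimization runs over triples of a candidate, a hint stack and a number of steps. The least
    successful triple may hold any provable candidate, so uniqueness is what makes the answer
    [v]. *)
Lemma search m g : computable g ->
  exists c, forall x v, provable m (g (pr x v)) ->
    (forall v', provable m (g (pr x v')) -> v' = v) -> eval c x v.
Proof.
move=> cg.
(* The input is [pr x s] with [s = pr v (pr hs n)]; value 0 means that [hs] empties the goal list in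
   [n] steps. *)
have [c cc] : computable (fun u => psnd (iter (psnd (psnd (psnd u))) (step_state m)
    (pr (pfst (psnd (psnd u))) (g (pr (pfst u) (pfst (psnd u))))))).
  apply: computable_psnd; apply: computable_iter; first exact: computable_step_state.
    by solve_computable.
  apply: computable_pr; first by solve_computable.
  by apply: computable_comp cg _; solve_computable.
exists (Comp Fst (Mu c)) => x v [n [hs nv]] uv.
pose halts s := psnd (iter (psnd (psnd s)) (step_state m)
  (pr (pfst (psnd s)) (g (pr x (pfst s))))) == 0.
have exs : exists s, halts s.
  by exists (pr v (pr hs n)); rewrite /halts !prE; apply/eqP.
case: (ex_minnP exs) => s /eqP hs0 smin; exists s; last first.
  exists (psnd s); rewrite -[v](uv (pfst s)) ?prK //.
  by exists (psnd (psnd s)), (pfst (psnd s)).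
split; first by have := cc (pr x s); rewrite !prE hs0.
move=> z zs; have := cc (pr x z); rewrite !prE.
case E: (psnd _) => [|w]; last by exists w.
by move: zs; rewrite ltnNge smin // /halts E.
Qed.

(** Searching for a proof that [e] maps [x] to [y] interprets [e]; determinism of evaluation
    supplies the uniqueness that [search] requires. *)
Lemma universal_code : exists u, forall e x y, app e x y -> eval u (pr e x) y.
Proof.
have [|u uP] := @search 0
    (fun z => gcons (geval (pfst (pfst z)) (psnd (pfst z)) (psnd z)) 0).
  by solve_computable.
exists u => e x y exy; apply: uP.
  by rewrite /= !prE; apply: provable_app => //; apply: provable0.
move=> z /provable_sound /all_hold_inv[]; rewrite /holds /= !prE => exz _.
by case: exy => c ce cy; apply: eval_fun cy; apply: exz.
Qed.

(** * Realizers of queries to [D], uniformly in [n] *)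

Lemma computable_const_code : computable (fun n => encode (const_code n)).
Proof.
have [c cc] := computable_iter (f := fun k => pr 5 (pr (encode Succ) k))
  (computable_pr (computable_const 5) (computable_pr (computable_const (encode Succ))
    computable_id)) computable_id (computable_const (encode Zero)).
exists c => n; have := cc n; congr eval.
by elim: n {cc} => //= n ->.
Qed.

(* For universal [u] this is <a, b> |-> a <n, b>. *)
Definition query_code (u : code) (n : nat) : code :=
  Comp u (Pair Fst (Pair (const_code n) Snd)).

(** An instance of the s-m-n theorem: [n] is built into the program as a constant. *)
Lemma computable_query_code u : computable (fun n => encode (query_code u n)).
Proof.
have cc := computable_const_code.
by rewrite /query_code /=; solve_computable.
Qed.

(** The only member of [rho D n] is [[set chi D n]], so a realizer [b] of [imp [set chi D n] q]
    makes [pr n b] an element of [mo (rho D) q], which [a] sends into [q]. *)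
Lemma query_lo u D n : (forall e x y, app e x y -> eval u (pr e x) y) ->
  lo (rho D) [set chi D n] (encode (query_code u n)).
Proof.
move=> uP q _ _ [a aP [b bP <-]].
have [|y aby qy] := aP (pr n b).
  exists n, b; split=> //; exists [set chi D n] => //.
  by rewrite /rho /chi; case: ifP.
exists y => //; exists (query_code u n) => //=.
exists (pr a (pr n b)); last exact: uP.
exists a, (pr n b); split=> //; first by exists b.
by exists n, b; split=> //; [apply: eval_const_code|exists a].
Qed.

(** * Majorities inside members of [O_ m alpha] *)

Lemma votes_weaken A m v e j k l :
  votes A m v e j k -> l <= k -> votes A m v e j l.
Proof.
move=> + lk; elim: j k l lk => [|j IHj] [|k] [|l] // lk.
all: try by move=> _; apply: votes_enough.
  by move/votes_inv.
move=> /votes_inv[vk|[y [ejy vy vk]]].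
  by apply: votes_skip; apply: IHj vk.
by apply: votes_take ejy vy _; apply: IHj vk.
Qed.

Lemma card_missing m alpha (A : set nat) : lt_ord (2 * m) alpha -> O_ m alpha A ->
  count (predC (mem A)) (iota 0 (2 * m).+1) <= m.
Proof.
move=> malpha [_ cA]; rewrite -size_filter.
set s := filter _ _.
(* Listing the missing numbers injects [I_(size s)] into the complement of [A] in [alpha], which has
   [m] elements. *)
have nthI : {in `I_(size s) &, injective (nth 0 s)}.
  move=> i j; rewrite !inE => si sj /eqP.
  by rewrite nth_uniq ?filter_uniq ?iota_uniq // => /eqP.
rewrite -card_le_II -(card_le_eqr cA) -(card_le_eql (inj_card_eq nthI)).
apply: subset_card_le => _ [i si <-].
have := mem_nth 0 si; rewrite mem_filter mem_iota /= => /andP[/negP iA im].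
split; last by move=> Ai; apply: iA; rewrite inE.
rewrite /ord_set /=; case: alpha malpha {cA} => //= a.
exact: leq_trans.
Qed.

Lemma votes_O m alpha A v e : lt_ord (2 * m) alpha -> O_ m alpha A ->
  imp A [set y | elects app m v y] e -> votes app m v e (2 * m).+1 m.+1.
Proof.
move=> malpha AO eA.
(* Every member of [A] below [j] casts a vote. *)
have vj j : votes app m v e j (count (mem A) (iota 0 j)).
  elim: j => [|j IHj]; first exact: votes_enough.
  rewrite -addn1 iotaD count_cat /= add0n addn0 addn1.
  case: (boolP (j \in A)) => jA; last by rewrite addn0; apply: votes_skip.
  have [|y ejy vy] := eA j; first by move: jA; rewrite inE.
  by rewrite addn1; apply: votes_take ejy vy IHj.
apply: votes_weaken (vj _) _.
have := count_predC (mem A) (iota 0 (2 * m).+1).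
rewrite size_iota => E.
have := card_missing malpha AO.
rewrite -(leq_add2l (count (mem A) (iota 0 (2 * m).+1))) E.
by rewrite mul2n -addnn -addSn leq_add2r.
Qed.

Definition node_code : code := Pair (const_code 1) Snd.
(** [Pair Fst Snd] is the identity because pairing is onto; the program realizes [[set v] => q_v]
    for every [v]. *)
Definition leaf_code : code := Pair Zero (Pair Fst Snd).

Lemma lo_elects m alpha v t : lt_ord (2 * m) alpha ->
  lo (fun _ => O_ m alpha) [set v] t ->
  exists2 y, app t (pr (encode node_code) (encode leaf_code)) y & elects app m v y.
Proof.
move=> malpha tv.
have [|y ty vy] := tv [set y | elects app m v y] I
  (pr (encode node_code) (encode leaf_code)).
  exists (encode node_code); last exists (encode leaf_code) => //.
    move=> x [n [e [-> [A AO eA]]]]; exists (pr 1 e).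
      exists node_code => //; exists 1, e.
      by split=> //; [apply: eval_const_code|exists n].
    by apply: elects_node; apply: votes_O malpha AO eA.
  move=> x ->; exists (pr 0 v); last exact: elects_leaf.
  exists leaf_code => //; exists 0, v; split=> //.
  exists (pfst v), (psnd v); split; last by rewrite prK.
    by exists (psnd v); rewrite prK.
  by exists (pfst v); rewrite prK.
by exists y.
Qed.

(** * The decision procedure for [D] *)

Theorem proposition3p5p19 (m : nat) (alpha : option nat) (D : set nat)
    (hm : 1 < 2 * m) (halpha : lt_ord (2 * m) alpha)
    (hD : effective_in D (fun _ : nat => O_ m alpha)) :
  recursive D.
Proof.
have [E EP] := hD; have [u uP] := universal_code.
pose s n := encode (query_code u n).
have sE n : exists t, app E (s n) t /\ lo (fun _ => O_ m alpha) [set chi D n] t.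
  have [t Et tn] := EP [set chi D n] I _ (query_lo uP).
  by exists t.
have [t tP] := choice sE.
(* [E] halts on every [s n], so [t] is total; the halting at [n = 0] already shows that [E] names a
   program. *)
have ct : computable t.
  have [c Ec _] : exists2 c, encode c = E & eval c (s 0) (t 0) by case: (tP 0).
  have [d ds] := computable_query_code u.
  exists (Comp c d) => n; exists (s n); first exact: ds.
  by have [[c']] := tP n; rewrite -Ec => /encode_inj ->.
pose ab := pr (encode node_code) (encode leaf_code).
have ct' : computable (fun z => t (pfst z)).
  by apply: computable_comp ct _; solve_computable.
(* The search looks for [pr v y] such that [t n] maps [ab] to [y] and [y] lies in [q_v]; [Fst] then
   returns [v]. *)
have [|c cP] := @search m (fun z => gcons (geval (t (pfst z)) ab (psnd (psnd z)))
    (gcons (gelects (pfst (psnd z)) (psnd (psnd z))) 0)).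
  by solve_computable.
exists (encode (Comp Fst c)) => n; exists (Comp Fst c) => //=.
have [_ /(lo_elects halpha)[y ty vy]] := tP n.
exists (pr (chi D n) y); last by exists y.
apply: cP.
  rewrite /= !prE; apply: provable_app ty _; apply: provable_elects vy _ _.
  exact: provable0.
(* Uniqueness: evaluation fixes [y], and disjointness of [q_0] and [q_1] fixes [v]. *)
move=> w /provable_sound /all_hold_inv[]; rewrite /holds /= !prE => tw /all_hold_inv[].
rewrite /holds !prE => vw _.
have Ew : psnd w = y by case: ty => d dt dy; apply: eval_fun dy; apply: tw.
by rewrite -(prK w) Ew (elects_unique vy (v' := pfst w)) // -Ew.
Qed.
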